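(* Let $m,n\in\mathbb N$ be standard and let $V=\{\xi_1,\dots,\xi_m\}$ be a set of vectors in $\mathbb E^n$, with $\xi_i=(\xi_{i1},\dots,\xi_{in})$ and $\xi_{ij}=a_{ij}+A_{ij}$ for $1\le i\le m$, $1\le j\le n$. Then: (1) $V$ is linearly dependent if and only if there exist representatives $x_i=(x_{i1},\dots,x_{in})\in\mathbb R^n$ of $\xi_i$, $1\le i\le m$, such that $x_1,\dots,x_m$ are linearly dependent. (2) $V$ is linearly independent if and only if every set $\{x_1,\dots,x_m\}$ of vectors in $\mathbb R^n$ with $x_i\in\xi_i$ for $1\le i\le m$ is linearly independent.
   Context: We work in nonstandard analysis with external sets (the theory HST of Kanovei and Reeken, extending a bounded form of Nelson's IST), so $\mathbb R$ contains nonstandard numbers. A neutrix is a convex additive subgroup of $\mathbb R$ (possibly an external set). An external number is a set $\alpha=a+A=\{a+x: x\in A\}$ with $a\in\mathbb R$ and $A$ a neutrix; $\mathbb E$ is the class of external numbers. Addition and multiplication by a real number are Minkowski operations: $(a+A)+(b+B)=(a+b)+(A+B)$, $t(a+A)=ta+tA$; they extend coordinatewise to $\mathbb E^n$. A representative of $\xi=(\xi_1,\dots,\xi_n)\in\mathbb E^n$ is a vector $x=(x_1,\dots,x_n)\in\mathbb R^n$ with $x_j\in\xi_j$ for all $j$ (written $x\in\xi$). A neutrix vector is a vector $(A_1,\dots,A_n)$ all of whose coordinates are neutrices. A set $\{\alpha_1,\dots,\alpha_m\}$ of vectors of $\mathbb E^n$ is linearly dependent if there exist real numbers $t_1,\dots,t_m$,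 at least one non-zero, and a neutrix vector $A$ such that $t_1\alpha_1+\cdots+t_m\alpha_m=A$; otherwise it is linearly independent. For vectors of $\mathbb R^n$ linear (in)dependence is the usual one, where the vectors are taken as an indexed family. *)

(* Defs.v *)
From HB Require Import structures.
From mathcomp Require Import all_boot all_order all_algebra.
From mathcomp Require Import all_classical all_reals.

Set Implicit Arguments.
Unset Strict Implicit.
Unset Printing Implicit Defensive.

Import Order.TTheory GRing.Theory Num.Theory.

Local Open Scope classical_set_scope.
Local Open Scope ring_scope.

(** The ambient type theory plays the role of the external universe of HST.
    In HST the well-founded real line is a complete ordered field, and the
    (internal) real line, on which the theory of neutrices takes place, is a
    proper extension of it satisfying Transfer.  Accordingly [R : realType] is
    the former, [S : realFieldType] the latter.  An external subset of the
    internal real line is an arbitrary [A : set S], and the standard natural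
    numbers are the elements of [nat]. *)

(** First-order formulas with variables in [nat] in the language having a
    symbol for every finitary relation on [T]. *)
Inductive formula (T : Type) : Type :=
| Rel (k : nat) (P : set (k.-tuple T)) (v : k.-tuple nat)
| Neg (f : formula T)
| And (f g : formula T)
| All (i : nat) (f : formula T).

Fixpoint holds (T U : Type)
    (I : forall k : nat, set (k.-tuple T) -> set (k.-tuple U))
    (e : nat -> U) (f : formula T) : Prop :=
  match f with
  | Rel k P v => I k P (map_tuple e v)
  | Neg f => ~ holds I e f
  | And f g => holds I e f /\ holds I e g
  | All i f => forall x : U, holds I [eta e with i |-> x] f
  end.

Definition add_graph (T : realFieldType) : set (3.-tuple T) :=
  [set t | tnth t 0 + tnth t 1 = tnth t 2].

Definition mul_graph (T : realFieldType) : set (3.-tuple T) :=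
  [set t | tnth t 0 * tnth t 1 = tnth t 2].

Definition le_graph (T : realFieldType) : set (2.-tuple T) :=
  [set t | tnth t 0 <= tnth t 1].

Record nonstandard_extension (R : realType) (S : realFieldType) := {
  star : R -> S;
  star_rel : forall k : nat, set (k.-tuple R) -> set (k.-tuple S);
  star_add : star_rel (@add_graph R) = @add_graph S;
  star_mul : star_rel (@mul_graph R) = @mul_graph S;
  star_le : star_rel (@le_graph R) = @le_graph S;
  star_transfer : forall (f : formula R) (e : nat -> R),
    holds (fun _ P => P) e f <-> holds star_rel (star \o e) f;
  star_proper : exists x : S, forall r : R, x <> star r }.

Record neutrix (S : realFieldType) := Neutrix {
  neutrix_set :> set S;
  neutrix_convex : forall x y z : S,
    neutrix_set x -> neutrix_set y -> x <= z <= y -> neutrix_set z;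
  neutrix0 : neutrix_set 0;
  neutrixB : forall x y : S,
    neutrix_set x -> neutrix_set y -> neutrix_set (x - y) }.

Definition translate (S : realFieldType) (a : S) (A : set S) : set S :=
  [set a + x | x in A].

Record external_number (S : realFieldType) := ExternalNumber {
  external_set :> set S;
  external_setP : exists (a : S) (A : neutrix S),
    external_set = translate a A }.

Definition minkowski_add (S : realFieldType) (X Y : set S) : set S :=
  [set x + y | x in X & y in Y].

Definition minkowski_scale (S : realFieldType) (t : S) (X : set S) : set S :=
  [set t * x | x in X].

Definition representative (S : realFieldType) (n : nat)
    (xi : 'rV[external_number S]_n) (x : 'rV[S]_n) : Prop :=
  forall j : 'I_n, (xi 0 j : set S) (x 0 j).

Definition external_dependent (S : realFieldType) (m n : nat)
    (xi : 'I_m -> 'rV[external_number S]_n) : Prop :=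
  exists t : 'I_m -> S, (exists i : 'I_m, t i != 0) /\
    exists A : 'rV[neutrix S]_n, forall j : 'I_n,
      \big[@minkowski_add S/[set 0]]_(i < m) minkowski_scale (t i) (xi i 0 j)
      = A 0 j :> set S.

Definition external_independent (S : realFieldType) (m n : nat)
    (xi : 'I_m -> 'rV[external_number S]_n) : Prop :=
  ~ external_dependent xi.

(* Main.v *)
Require Import Defs.
From mathcomp Require Import all_boot all_order all_algebra.
From mathcomp Require Import all_classical all_reals.

Set Implicit Arguments.
Unset Strict Implicit.
Unset Printing Implicit Defensive.

Import Order.TTheory GRing.Theory Num.Theory.

Local Open Scope classical_set_scope.
Local Open Scope ring_scope.

(** Everything rests on one observation about the Minkowski combination
    [t_1 xi_1 + ... + t_m xi_m] of external numbers.  Neutrices are stable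
    under sums, because any two of them are comparable ([neutrix_total],
    [add_neutrix]), and under multiplication by a scalar ([scale_neutrix]), and any representative of an external number may serve
    as its center ([translate_recenter]); so, whatever representatives [x_i]
    are chosen, the combination is a neutrix translated by
    [t_1 x_1 + ... + t_m x_m] ([combination_translate]).

    If representatives satisfy a nontrivial linear relation with coefficients
    [t_i], the translation is by [0] in every coordinate, hence the same
    coefficients make each coordinate of the combination of the [xi_i] a
    neutrix.  Conversely a neutrix contains [0], and an element of a Minkowski
    combination is by construction the corresponding combination of some
    representatives ([mem_combination]); choosing these in each coordinate
    separately gives vectors annihilated by the [t_i].  The second equivalence
    is the contrapositive of the first. *)

Section Neutrices.
Variable S : realFieldType.
Implicit Types (A B : neutrix S) (x y z t : S).

Lemma neutrixN A x : neutrix_set A x -> neutrix_set A (- x).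
Proof. by move=> Ax; rewrite -sub0r; apply: neutrixB => //; exact: neutrix0. Qed.

Lemma neutrixD A x y : neutrix_set A x -> neutrix_set A y -> neutrix_set A (x + y).
Proof. by move=> Ax Ay; rewrite -[y]opprK; apply/neutrixB/neutrixN. Qed.

Lemma neutrix_le_norm A x y :
  neutrix_set A x -> `|y| <= `|x| -> neutrix_set A y.
Proof.
move=> Ax; have An : neutrix_set A `|x| by case: (ger0P x) => // _; exact: neutrixN.
rewrite ler_norml => yx; exact: (neutrix_convex (neutrixN An) An).
Qed.

(** A neutrix is determined by the absolute values of its elements, which form
    an initial segment of the nonnegative numbers; initial segments of a total
    order are comparable. *)
Lemma neutrix_total A B : A `<=` B \/ B `<=` A.
Proof.
have [|nAB] := pselect (A `<=` B); [by left | right => b Bb].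
have [a Aa nBa] : exists2 a, neutrix_set A a & ~ neutrix_set B a.
  apply: contrapT => H; apply: nAB => a Aa.
  by apply: contrapT => ?; apply: H; exists a.
apply: neutrix_le_norm Aa _; rewrite leNgt; apply/negP => /ltW ab.
exact/nBa/(neutrix_le_norm Bb).
Qed.

Lemma minkowski_addC (X Y : set S) : minkowski_add X Y = minkowski_add Y X.
Proof.
by apply/seteqP; split=> _ [x Xx [y Yy <-]]; exists y => //; exists x => //;
  rewrite addrC.
Qed.

Lemma add_sub_neutrix A B : A `<=` B -> minkowski_add A B = B.
Proof.
move=> AB; apply/seteqP; split=> [_ [x Ax [y By <-]]|y By].
  exact: neutrixD (AB _ Ax) By.
by exists 0; [exact: neutrix0 | exists y; rewrite ?add0r].
Qed.

(** Convexity of the sum comes for free: of two neutrices one contains the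
    other, and the larger one is their sum. *)
Lemma add_neutrix A B : exists C : neutrix S, C = minkowski_add A B :> set S.
Proof.
have [AB|BA] := neutrix_total A B; first by exists B; rewrite add_sub_neutrix.
by exists A; rewrite minkowski_addC add_sub_neutrix.
Qed.

Lemma zero_neutrix : exists C : neutrix S, C = [set 0] :> set S.
Proof.
have cvx x y z : [set 0] x -> [set 0] y -> x <= z <= y -> [set 0] z.
  by move=> -> -> z0; apply/eqP; rewrite eq_le andbC.
have sub x y : [set 0] x -> [set 0] y -> [set 0] (x - y).
  by move=> -> ->; rewrite /= subr0.
by exists (Neutrix cvx erefl sub).
Qed.

Lemma scale_neutrix t A : exists C : neutrix S, C = minkowski_scale t A :> set S.
Proof.
have sA0 : minkowski_scale t A 0 by exists 0; [exact: neutrix0 | rewrite mulr0].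
have sub x y : minkowski_scale t A x -> minkowski_scale t A y ->
    minkowski_scale t A (x - y).
  move=> [u Au <-] [v Av <-]; exists (u - v); last by rewrite mulrBr.
  exact: neutrixB.
have cvx x y z : minkowski_scale t A x -> minkowski_scale t A y ->
    x <= z <= y -> minkowski_scale t A z.
  move=> [u Au <-] [v Av <-] /andP[uz zv].
  (* A negative scalar swaps the two bounds. *)
  have [t0|t0|t0] := ltgtP t 0.
  - exists (z / t); last by rewrite mulrC divfK // lt_eqF.
    by apply: (neutrix_convex Av Au); rewrite ler_ndivlMr // ler_ndivrMr //
      ![_ * t]mulrC zv uz.
  - exists (z / t); last by rewrite mulrC divfK // gt_eqF.
    by apply: (neutrix_convex Au Av); rewrite ler_pdivlMr // ler_pdivrMr //
      ![_ * t]mulrC zv uz.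
  - suff -> : z = 0 by [].
    by apply/eqP; rewrite eq_le; move: uz zv; rewrite t0 !mul0r => -> ->.
by exists (Neutrix cvx sA0 sub).
Qed.

Lemma translate0 (X : set S) : translate 0 X = X.
Proof.
by apply/seteqP; split=> [_ [x Xx <-]|x Xx]; [|exists x => //]; rewrite add0r.
Qed.

(** Two representatives differ by an element of the neutrix, which the neutrix
    absorbs. *)
Lemma translate_recenter a x A :
  translate a A x -> translate a A = translate x A.
Proof.
move=> [u Au <-]; apply/seteqP; split=> _ [v Av <-].
- by exists (v - u); [exact: neutrixB | rewrite addrACA subrr addr0 -?addrA addrC].
- by exists (u + v); [exact: neutrixD | rewrite addrA].
Qed.

Lemma add_translate x y (X Y : set S) :
  minkowski_add (translate x X) (translate y Y) =
  translate (x + y) (minkowski_add X Y).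
Proof.
apply/seteqP; split=> [_ [_ [u Xu <-] [_ [v Yv <-] <-]]|_ [_ [u Xu [v Yv <-]] <-]].
- by exists (u + v); [exists u => //; exists v | rewrite addrACA].
- by exists (x + u); [exists u | exists (y + v); [exists v | rewrite addrACA]].
Qed.

Lemma scale_translate t x (X : set S) :
  minkowski_scale t (translate x X) = translate (t * x) (minkowski_scale t X).
Proof.
apply/seteqP; split=> [_ [_ [u Xu <-] <-]|_ [_ [u Xu <-] <-]].
- by exists (t * u); [exists u | rewrite mulrDr].
- by exists (x + u); [exists u | rewrite mulrDr].
Qed.

Lemma external_numberE (X : external_number S) x :
  (X : set S) x -> exists A, X = translate x A :> set S.
Proof.
by have [a [A ->]] := external_setP X; exists A; exact: translate_recenter.
Qed.

(** Recentering every summand at the chosen representative is what makes the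
    same neutrix-translate description available for all choices of [x]. *)
Lemma combination_translate m (t : 'I_m -> S) (X : 'I_m -> external_number S)
    (x : 'I_m -> S) : (forall i, (X i : set S) (x i)) ->
  exists A, \big[@minkowski_add S/[set 0]]_(i < m) minkowski_scale (t i) (X i)
    = translate (\sum_(i < m) t i * x i) A.
Proof.
move=> Xx; apply: (big_ind2 (fun Y y => exists A, Y = translate y A)).
- by have [O eO] := zero_neutrix; exists O; rewrite eO translate0.
- move=> _ y1 _ y2 [A1 ->] [A2 ->]; have [A eA] := add_neutrix A1 A2.
  by exists A; rewrite eA add_translate.
- move=> i _; have [B ->] := external_numberE (Xx i).
  by have [A eA] := scale_neutrix (t i) B; exists A; rewrite eA scale_translate.
Qed.

Lemma mem_combination m (t : 'I_m -> S) (X : 'I_m -> set S) z :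
  (\big[@minkowski_add S/[set 0]]_(i < m) minkowski_scale (t i) (X i)) z ->
  exists x : 'I_m -> S, (forall i, X i (x i)) /\ z = \sum_(i < m) t i * x i.
Proof.
elim: m t X z => [|m IH] t X z.
  by rewrite big_ord0 => ->; exists (fun=> 0); split; [case | rewrite big_ord0].
rewrite big_ord_recl => -[_ [u Xu <-] [_ /IH [x [Xx ->]] <-]].
exists (fun i => if unlift ord0 i is Some k then x k else u); split.
  by move=> i; case: unliftP => [k|] ->.
rewrite big_ord_recl unlift_none; congr (_ + _).
by apply: eq_bigr => i _; rewrite liftK.
Qed.

End Neutrices.

Lemma not_free_rowsP (F : fieldType) m n (x : 'I_m -> 'rV[F]_n) :
  ~~ free [tuple x i | i < m] <->
  exists t : 'I_m -> F, (exists i, t i != 0) /\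
    forall j, \sum_(i < m) t i * x i 0 j = 0.
Proof.
have relE (t : 'I_m -> F) : \sum_(i < m) t i *: [tuple x i | i < m]`_i = 0 <->
    forall j, \sum_(i < m) t i * x i 0 j = 0.
  have -> : \sum_(i < m) t i *: [tuple x i | i < m]`_i = \sum_(i < m) t i *: x i.
    by apply: eq_bigr => i _; rewrite -tnth_nth tnth_mktuple.
  have sumE j : (\sum_(i < m) t i *: x i) 0 j = \sum_(i < m) t i * x i 0 j.
    by rewrite summxE; apply: eq_bigr => i _; rewrite mxE.
  split=> [H j|H]; first by rewrite -sumE H mxE.
  by apply/rowP => j; rewrite sumE H mxE.
split=> [/negP nfree|[t [[i ti0] tx]]].
- apply: contrapT => H; apply: nfree; apply/freeP => t /relE tx i.
  apply/eqP; apply: contrapT => /negP ti0.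
  by apply: H; exists t; split; [exists i|].
- by apply/negP => /freeP/(_ t)/(_ (proj2 (relE t) tx) i)/eqP; rewrite (negPf ti0).
Qed.

Lemma external_dependentP (S : realFieldType) m n
    (xi : 'I_m -> 'rV[external_number S]_n) :
  external_dependent xi <->
  exists x : 'I_m -> 'rV[S]_n,
    (forall i, representative (xi i) (x i)) /\ ~~ free [tuple x i | i < m].
Proof.
split=> [[t [tn0 [A hA]]]|[x [xix /not_free_rowsP [t [tn0 tx]]]]].
- have /choice [y hy] : forall j, exists y : 'I_m -> S,
      (forall i, (xi i 0 j : set S) (y i)) /\ 0 = \sum_(i < m) t i * y i.
    move=> j; apply: (@mem_combination _ _ t (fun i => xi i 0 j)).
    by rewrite hA; exact: neutrix0.
  exists (fun i => \row_j y j i); split.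
    by move=> i j; rewrite mxE; have [] := hy j.
  apply/not_free_rowsP; exists t; split=> // j; have [_ e0] := hy j.
  by rewrite [RHS]e0; apply: eq_bigr => i _; rewrite mxE.
- exists t; split=> //.
  have /choice [A hA] : forall j, exists A : neutrix S,
      \big[@minkowski_add S/[set 0]]_(i < m) minkowski_scale (t i) (xi i 0 j)
      = A :> set S.
    move=> j; have [A ->] := combination_translate t (fun i => xix i j).
    by exists A; rewrite tx translate0.
  by exists (\row_j A j) => j; rewrite mxE.
Qed.

Theorem theorem6p6 (R : realType) (S : realFieldType)
    (nsa : nonstandard_extension R S) (m n : nat)
    (xi : 'I_m -> 'rV[external_number S]_n)
    (a : 'I_m -> 'I_n -> S) (A : 'I_m -> 'I_n -> neutrix S)
    (hxi : forall (i : 'I_m) (j : 'I_n),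
       xi i 0 j = translate (a i j) (A i j) :> set S) :
  (external_dependent xi <->
     exists x : 'I_m -> 'rV[S]_n,
       (forall i : 'I_m, representative (xi i) (x i)) /\
       ~~ free [tuple x i | i < m]) /\
  (external_independent xi <->
     forall x : 'I_m -> 'rV[S]_n,
       (forall i : 'I_m, representative (xi i) (x i)) ->
       free [tuple x i | i < m]).
Proof.
split; first exact: external_dependentP.
rewrite /external_independent external_dependentP; split=> [H x xix|H [x [xix]]].
- by apply: contrapT => /negP nfree; apply: H; exists x.
- by rewrite H.
Qed.
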